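(* Let $\rho$ be an $n$-fermion density matrix on $\mathcal H_n$ and let $|G\rangle$ be a Slater determinant such that $\alpha=\langle G|\rho|G\rangle\ge 2/3$. Then every Slater determinant $|H\rangle$ satisfies $$\langle H|\rho|H\rangle\ \le\ \alpha-\left(\frac{3\alpha}{2}-1\right)\left(1-|\langle G|H\rangle|^2\right)+2R_G\sqrt{1-|\langle G|H\rangle|^2}.$$ In particular, if $\alpha>2/3$ and $R_G=0$, then $|G\rangle$ is the unique globally closest Slater determinant to $\rho$ (the unique maximizer of $\langle S|\rho|S\rangle$ over Slater determinants), up to phase. Moreover, if $\alpha\ge 2/3+\Delta$ for some $\Delta>0$, then $$\mathsf{OPT}\ \le\ \alpha+\frac23\,\frac{R_G^2}{\Delta}.$$
   Context: $\mathcal H_1$ is an $m$-dimensional complex Hilbert space, $n\le m$, $\mathcal H_n=\wedge^n\mathcal H_1$, and the set $\mathcal S$ of Slater determinants consists of the unit vectors $|\varphi_1\rangle\wedge\cdots\wedge|\varphi_n\rangle$ with $\varphi_i\in\mathcal H_1$ orthonormal. $\mathsf{OPT}=\max_{|S\rangle\in\mathcal S}\langle S|\rho|S\rangle$. For a Slater determinant $|G\rangle=c_{g_1}^\dagger\cdots c_{g_n}^\dagger|0\rangle$ with orthonormal occupied orbitals $g_\mu$, let $f_1,\dots,f_{m-n}$ be an orthonormal basis of the orthogonal complement of $\operatorname{span}\{g_\mu\}$ (unoccupied orbitals), $c_v^\dagger$ the fermionic creation operator of orbital $v$, and $|G_{a\mu}\rangle=c_{f_a}^\dagger c_{g_\mu}|G\rangle$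 the single particle-hole excitations. With $\Pi_1^G$ the orthogonal projector onto $\operatorname{span}\{|G_{a\mu}\rangle\}$, the mixed residual is $R_G=\|\Pi_1^G\rho|G\rangle\|=\sqrt{\sum_{a,\mu}|\langle G_{a\mu}|\rho|G\rangle|^2}$. *)

(* Defs.v *)
From HB Require Import structures.
From mathcomp Require Import all_boot all_order all_algebra.
From mathcomp Require Import complex.
From mathcomp Require Import boolp classical_sets reals.
Set Implicit Arguments.
Unset Strict Implicit.
Unset Printing Implicit Defensive.
Import Order.TTheory GRing.Theory Num.Theory.
Local Open Scope ring_scope.
Local Open Scope sesquilinear_scope.

(* The one-particle space is C^m, whose vectors (orbitals) are rows 'rV[C]_m, so
   that a family of orthonormal orbitals is a matrix in [unitarymx] (M *m M^t* = 1,
   M not necessarily square).  The Fock space (the exterior algebra of C^m) has the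
   occupation-number basis |A>, A a set of modes; its vectors are columns indexed by
   the enumeration of {set 'I_m}, and |A> stands for e_{i_1} /\ ... /\ e_{i_k}
   with A = {i_1 < ... < i_k}. *)
Definition fock_dim (m : nat) : nat := #|{: {set 'I_m}}|.

Definition occupied (m : nat) (A : 'I_(fock_dim m)) : {set 'I_m} := enum_val A.

Section Fock.
Variables (C : numClosedFieldType) (m : nat).
Local Notation N := (fock_dim m).

Definition vacuum : 'cV[C]_N := \col_A (occupied A == finset.set0)%:R.

(* c_i^dag |B> = (-1)^#{j in B, j < i} |i |: B> if i is not in B, and 0 otherwise. *)
Definition creation_mode (i : 'I_m) : 'M[C]_N :=
  \matrix_(A, B)
    (((i \notin occupied B) && (occupied A == i |: occupied B))%:R
       * (-1) ^+ #|[set j in occupied B | (j < i)%N]|).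

Definition creation (v : 'rV[C]_m) : 'M[C]_N :=
  \sum_i v 0 i *: creation_mode i.

Definition annihilation (v : 'rV[C]_m) : 'M[C]_N := (creation v)^t*.

(* phi_1 /\ ... /\ phi_n = c_{phi_1}^dag ... c_{phi_n}^dag |0> *)
Definition wedge (n : nat) (phi : 'M[C]_(n, m)) : 'cV[C]_N :=
  (\prod_(k < n) creation (row k phi)) *m vacuum.

Definition slater (n : nat) : set 'cV[C]_N :=
  [set S | exists2 phi : 'M[C]_(n, m), phi \is unitarymx & S = wedge phi].

(* The orthogonal projector of Fock space onto H_n = /\^n C^m. *)
Definition sector_proj (n : nat) : 'M[C]_N :=
  diag_mx (\row_A (#|occupied A| == n)%:R).

(* Density matrices on H_n, as operators on Fock space acting within H_n. *)
Definition density (n : nat) (rho : 'M[C]_N) : Prop :=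
  [/\ sector_proj n *m rho *m sector_proj n = rho,
      rho \is hermsymmx,
      forall u : 'cV[C]_N, 0 <= (u^t* *m rho *m u) 0 0
    & \tr rho = 1].

(* |G_{a mu}> = c_{f_a}^dag c_{g_mu} |G> *)
Definition excitation (n p : nat) (g : 'M[C]_(n, m)) (f : 'M[C]_(p, m))
    (a : 'I_p) (mu : 'I_n) : 'cV[C]_N :=
  creation (row a f) *m annihilation (row mu g) *m wedge g.

(* [proj_ortho] acts on row vectors from the right, hence the transpositions. *)
Definition excitation_proj (n p : nat) (g : 'M[C]_(n, m)) (f : 'M[C]_(p, m)) :
    'M[C]_N :=
  (proj_ortho (\sum_(a < p) \sum_(mu < n) <<(excitation g f a mu)^T>>)%MS)^T.

End Fock.

Import ComplexField.Normc.

Section Functionals.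
Variables (R : realType) (m : nat).
Local Notation C := R[i].
Local Notation N := (fock_dim m).

Definition fidelity (rho : 'M[C]_N) (S : 'cV[C]_N) : R :=
  complex.Re ((S^t* *m rho *m S) 0 0).

Definition overlap2 (S T : 'cV[C]_N) : R :=
  normc ((S^t* *m T) 0 0) ^+ 2.

Definition vnorm (u : 'cV[C]_N) : R :=
  Num.sqrt (\sum_A normc (u A 0) ^+ 2).

Definition residual (n p : nat) (rho : 'M[C]_N) (g : 'M[C]_(n, m))
    (f : 'M[C]_(p, m)) : R :=
  vnorm (excitation_proj g f *m rho *m wedge g).

(* The supremum is a maximum: the Slater determinants form a compact set. *)
Definition OPT (n : nat) (rho : 'M[C]_N) : R :=
  sup [set fidelity rho S | S in @slater C m n]%classic.

End Functionals.

(* Main.v *)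
(* Write H = c G + w with c = <G|H> and w orthogonal to G, x = 1 - |c|^2 = |w|^2,
   rho G = alpha G + r with r orthogonal to G, and P = Pi_1^G.  Subtracting from rho
   the rank-one operator |rho G><rho G| / alpha leaves a positive operator of trace
   1 - (alpha^2 + |r|^2) / alpha, which bounds <w|rho|w>.  With a = |P w|,
   b = |w - P w|, p = |P r| = R_G and q = |r - P r|, the claim reduces to
     2 |c| (a p + b q) <= alpha x / 2 + (a q - b p)^2 / alpha + 2 p sqrt x,
   which follows by AM-GM from |c| b <= a sqrt (x / 2).  The latter says that an
   overlap with doubly or more excited states forces an overlap with the single
   excitations: if H = wedge psi, A = psi g^* and B = psi f^*, then A A^* + B B^* = 1,
   c = det A, the amplitudes <G_{a mu}|H> are the entries of adj A * B, and with
   1 / (1 + t_i) the eigenvalues of A A^* it becomes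
     2 (prod (1 + t_i) - 1) <= (sum t_i) (prod (1 + t_i) + 1). *)
Require Import Defs.
From mathcomp Require Import all_boot all_order all_algebra.
From mathcomp Require Import complex.
From mathcomp Require Import boolp classical_sets reals.
From mathcomp Require Import finset ring lra.
Import Order.TTheory GRing.Theory Num.Theory.
Local Open Scope ring_scope.
Local Open Scope sesquilinear_scope.

Set Implicit Arguments.
Unset Strict Implicit.
Unset Printing Implicit Defensive.

(** * A determinant inequality for two blocks of a matrix with orthonormal rows *)

Section Matrix.
Variables (C : numClosedFieldType).

Lemma adjM a b c (A : 'M[C]_(a, b)) (B : 'M[C]_(b, c)) :
  (A *m B)^t* = B^t* *m A^t*.
Proof. by rewrite trmx_mul map_mxM. Qed.

Lemma adjZ a b (x : C) (A : 'M[C]_(a, b)) : (x *: A)^t* = x^* *: A^t*.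
Proof. by rewrite linearZ /= map_mxZ. Qed.

(** Induction on the number of factors; the signs of the sum and of the product minus 1 are carried
    along because the step uses both. *)
Lemma prod_sum_ineq n (t : 'I_n -> C) : (forall i, 0 <= t i) ->
  2 * (\prod_i (1 + t i) - 1) <= (\sum_i t i) * (\prod_i (1 + t i) + 1).
Proof.
move=> t0; rewrite -subr_ge0.
suff [] : [/\ 0 <= \sum_i t i, 0 <= \prod_i (1 + t i) - 1 &
  0 <= (\sum_i t i) * (\prod_i (1 + t i) + 1) - 2 * (\prod_i (1 + t i) - 1)].
  by [].
elim: n t t0 => [|n IH] t t0.
  by rewrite !big_ord0 subrr mul0r mulr0 subrr.
rewrite !big_ord_recl; set T := \sum_i _; set P := \prod_i _.
have [T0 P1 E0] : [/\ 0 <= T, 0 <= P - 1 & 0 <= T * (P + 1) - 2 * (P - 1)].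
  by apply: IH => i.
move: (t ord0) (t0 ord0) T P T0 P1 E0 => s s0 T P T0 P1 E0.
have P0 : 0 <= P by rewrite -[P](subrK 1) addr_ge0.
split; first exact: addr_ge0.
  have -> : (1 + s) * P - 1 = P - 1 + s * P by ring.
  exact: addr_ge0 P1 (mulr_ge0 s0 P0).
(* The new difference is the old one plus nonnegative terms. Its part linear in s is T P - P + 1,
   which is half the sum of the old difference and T (P - 1). *)
have -> : (s + T) * ((1 + s) * P + 1) - 2 * ((1 + s) * P - 1)
  = (T * (P + 1) - 2 * (P - 1))
    + s / 2 * ((T * (P + 1) - 2 * (P - 1)) + T * (P - 1)) + s * s * P by field.
apply: addr_ge0; last exact: mulr_ge0 (mulr_ge0 s0 s0) P0.
apply: addr_ge0 => //; apply: mulr_ge0; first exact: divr_ge0.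
exact: addr_ge0 E0 (mulr_ge0 T0 P1).
Qed.

Lemma mul_adj_diag_ge0 n p (A : 'M[C]_(n, p)) i : 0 <= (A *m A^t*) i i.
Proof.
rewrite mxE sumr_ge0 // => j _; rewrite !mxE.
exact: mul_conjC_ge0.
Qed.

Lemma det_adj n (A : 'M[C]_n) : \det (A^t*) = (\det A)^*.
Proof. by rewrite det_map_mx det_tr. Qed.

(** Here adj A = det A times A^* d^-1, so the trace is |det A|^2 times the sum of t_i = 1 / d_i - 1,
    while the product of the 1 + t_i is 1 / |det A|^2. Multiplying [prod_sum_ineq] by |det A|^4
    gives the claim. *)
Lemma cofactor_block_diag n p (A : 'M[C]_n) (B : 'M[C]_(n, p)) (d : 'rV[C]_n) :
  \det A != 0 -> A *m A^t* = diag_mx d -> A *m A^t* + B *m B^t* = 1%:M ->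
  2 * (`|\det A| ^+ 2 * (1 - `|\det A| ^+ 2))
    <= \tr (\adj A *m B *m (\adj A *m B)^t*) * (1 + `|\det A| ^+ 2).
Proof.
move=> dA AA AB; set M := \adj A *m B.
have c2E : `|\det A| ^+ 2 = \prod_i d 0 i.
  by rewrite -det_diag -AA det_mulmx det_adj normCK.
have d0 i : 0 <= d 0 i.
  by have := mul_adj_diag_ge0 A i; rewrite AA mxE eqxx.
have d1 i : 0 <= 1 - d 0 i.
  have := mul_adj_diag_ge0 B i.
  by rewrite (canRL (addKr _) AB) AA !mxE eqxx addrC.
have dn0 i : d 0 i != 0.
  apply: contra_neq dA => di; apply/eqP; rewrite -normr_eq0 -sqrf_eq0 c2E.
  by rewrite (bigD1 i) //= di mul0r.
pose e := \row_i (d 0 i)^-1 : 'rV[C]_n.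
have de : diag_mx d *m diag_mx e = 1%:M.
  rewrite mulmx_diag -diag_const_mx; congr diag_mx.
  by apply/rowP => i; rewrite !mxE mulfV.
have adjE : \adj A = \det A *: (A^t* *m diag_mx e).
  by rewrite -[LHS]mulmx1 -de -AA !mulmxA mul_adj_mx mul_scalar_mx -!scalemxAl.
have eadj : (diag_mx e)^t* = diag_mx e.
  rewrite tr_diag_mx map_diag_mx; congr diag_mx; apply/rowP => i; rewrite !mxE fmorphV.
  by congr _^-1; exact: geC0_conj (d0 i).
have KE : \tr (M *m M^t*) = `|\det A| ^+ 2 * \sum_i ((d 0 i)^-1 - 1).
  have BB : B *m B^t* = diag_mx (\row_i (1 - d 0 i)).
    rewrite (canRL (addKr _) AB) AA -diag_const_mx -raddfN -raddfD.
    by congr diag_mx; apply/rowP => i; rewrite !mxE addrC.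
  have -> : M *m M^t* = `|\det A| ^+ 2 *:
      (A^t* *m (diag_mx e *m diag_mx (\row_i (1 - d 0 i)) *m diag_mx e *m A)).
    rewrite /M adjM -mulmxA [B *m (_ *m _)]mulmxA BB adjE adjZ adjM eadj trmxCK.
    by rewrite -!scalemxAl -!scalemxAr scalerA -normCK !mulmxA.
  rewrite mxtraceZ mxtrace_mulC -(mulmxA _ A) AA !mulmx_diag mxtrace_diag.
  by congr (_ * _); apply: eq_bigr => i _; rewrite !mxE; field.
have ci0 : `|\det A| ^+ 2 != 0 by rewrite sqrf_eq0 normr_eq0.
have cV : \prod_i (1 + ((d 0 i)^-1 - 1)) = (`|\det A| ^+ 2)^-1.
  by rewrite c2E -prodfV; apply: eq_bigr => i _; rewrite addrC subrK.
have ci := exprn_ge0 2 (normr_ge0 (\det A)).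
have := @prod_sum_ineq n (fun i => (d 0 i)^-1 - 1).
rewrite cV KE; move: (\sum_i _) (`|_| ^+ 2) ci0 ci => T c c0 ci ineq.
rewrite -subr_ge0 (_ : _ - _ =
  c ^+ 2 * (T * (c^-1 + 1) - 2 * (c^-1 - 1))); last by field.
rewrite mulr_ge0 ?exprn_ge0 // subr_ge0 ineq // => i.
by rewrite (_ : _ - 1 = (1 - d 0 i) / d 0 i) ?divr_ge0 //; field.
Qed.

(** Replacing A and B by U A and U B with U unitary changes neither side, so the spectral theorem
    reduces to diagonal A A^*. If A is singular, the left side is 0. *)
Lemma cofactor_block n p (A : 'M[C]_n) (B : 'M[C]_(n, p)) :
  A *m A^t* + B *m B^t* = 1%:M ->
  2 * (`|\det A| ^+ 2 * (1 - `|\det A| ^+ 2))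
    <= \tr (\adj A *m B *m (\adj A *m B)^t*) * (1 + `|\det A| ^+ 2).
Proof.
move=> AB; have [dA|dA] := eqVneq (\det A) 0.
  rewrite dA normr0 expr0n /= mul0r mulr0 addr0 mulr1.
  by apply: sumr_ge0 => i _; exact: mul_adj_diag_ge0.
set U := spectralmx (A *m A^t*).
have UU : U \is unitarymx by exact: spectral_unitarymx.
have UUV : U *m U^t* = 1%:M by exact/unitarymxP.
have VU : U^t* *m U = 1%:M by exact: mulmx1C.
set D := spectral_diag (A *m A^t*).
have hA : A *m A^t* \is normalmx.
  by apply/normalmxP; rewrite adjM trmxCK.
have /orthomx_spectralP := hA; rewrite -/U -/D invmx_unitary // => AAE.
have nU : `|\det U| ^+ 2 = 1 by rewrite normCK -det_adj -det_mulmx UUV det1.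
have nU1 : `|\det U| = 1.
  by apply/eqP; rewrite -(@pexpr_eq1 _ _ 2) // nU.
have UAA : U *m A *m (U *m A)^t* = diag_mx D.
  rewrite adjM mulmxA -(mulmxA U) AAE !mulmxA UUV mul1mx -mulmxA UUV.
  exact: mulmx1.
have UAB : U *m A *m (U *m A)^t* + U *m B *m (U *m B)^t* = 1%:M.
  rewrite !adjM !mulmxA -mulmxDl -![U *m _ *m _]mulmxA -mulmxDr AB mulmx1.
  exact: UUV.
have dU0 : \det U != 0 by rewrite -normr_eq0 nU1 oner_eq0.
have dUA : \det (U *m A) != 0 by rewrite det_mulmx mulf_neq0.
have := cofactor_block_diag dUA UAA UAB.
(* As A is invertible, adj (U A) U = det U adj A may be checked after multiplying by A on the right,
   where both sides are the scalar det (U A). *)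
have -> : \adj (U *m A) *m (U *m B) = \det U *: (\adj A *m B).
  have uA : A \in unitmx by rewrite unitmxE unitfE.
  rewrite mulmxA scalemxAl; congr (_ *m B); apply: (can_inj (mulmxK uA)).
  rewrite -mulmxA mul_adj_mx -scalemxAl mul_adj_mx det_mulmx.
  by rewrite scale_scalar_mx.
rewrite adjZ -scalemxAl -scalemxAr scalerA -normCK nU scale1r.
by rewrite det_mulmx normrM nU1 mul1r.
Qed.

End Matrix.

(** * Canonical anticommutation relations in the occupation-number basis *)

Section Fock.
Variables (C : numClosedFieldType) (m : nat).
Implicit Types (A B D : {set 'I_m}) (i j : 'I_m).
Local Notation N := (fock_dim m).

Definition mode_sign i B : C := (-1) ^+ #|[set j in B | (j < i)%N]|.

(** The matrix entry <A|c_i^dag|B>, indexed by sets instead of their ranks, so that sums over the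
    basis become sums over sets through [sum_occupied]. *)
Definition mode_coef i A B : C :=
  ((i \notin B) && (A == i |: B))%:R * mode_sign i B.

Lemma creation_modeE i (a b : 'I_N) :
  creation_mode C i a b = mode_coef i (occupied a) (occupied b).
Proof. by rewrite mxE. Qed.

Lemma occupied_inj : injective (@occupied m).
Proof. exact: enum_val_inj. Qed.

Lemma sum_occupied (F : {set 'I_m} -> C) :
  \sum_(a : 'I_N) F (occupied a) = \sum_A F A.
Proof.
rewrite (reindex (@occupied m)) //=.
exists enum_rank => x _; [exact: enum_valK | exact: enum_rankK].
Qed.

Lemma mode_signV i B : mode_sign i B * mode_sign i B = 1.
Proof. by rewrite -expr2 -exprM muln2 -signr_odd odd_double. Qed.

Lemma mode_signU i j B : j \notin B ->
  mode_sign i (j |: B) = (-1) ^+ (j < i)%N * mode_sign i B.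
Proof.
move=> jB; rewrite /mode_sign -exprD; congr (_ ^+ _).
have [ji|ji] := boolP (j < i)%N.
  rewrite (_ : [set _ in _ | _] = j |: [set k in B | (k < i)%N]).
    by rewrite cardsU1 inE (negbTE jB).
  apply/setP => k; rewrite !inE; have [->|] := eqVneq k j; rewrite /= ?ji //.
rewrite add0n; congr #|pred_of_set _|; apply/setP => k; rewrite !inE.
by have [->|] := eqVneq k j; rewrite //= (negbTE jB) (negbTE ji).
Qed.

(** The entry <A|c_i c_j^dag + c_j^dag c_i|B>. Each sum has at most one nonzero term, at D = A plus
    i and at D = A minus j respectively. For i = j exactly one of the two survives on the diagonal;
    for distinct modes the two terms cancel by their signs. *)
Lemma mode_anticomm i j A B :
  \sum_D mode_coef i D A * mode_coef j D B
   + \sum_D mode_coef j A D * mode_coef i B D = ((i == j) && (A == B))%:R.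
Proof.
have -> : \sum_D mode_coef i D A * mode_coef j D B =
    (i \notin A)%:R * mode_sign i A * mode_coef j (i |: A) B.
  rewrite (bigD1 (i |: A)) //= big1 ?addr0 ?/mode_coef ?eqxx ?andbT // => D nD.
  by rewrite (negbTE nD) andbF !mul0r.
have -> : \sum_D mode_coef j A D * mode_coef i B D =
    (j \in A)%:R * mode_sign j (A :\ j) * mode_coef i B (A :\ j).
  rewrite (bigD1 (A :\ j)) //= big1 ?addr0 ?/mode_coef => [|D nD].
    rewrite setD11 /=; congr ((nat_of_bool _)%:R * _ * _).
    have [jA|jA] := boolP (j \in A); first by rewrite setD1K // eqxx.
    by apply/negbTE/eqP => Aj; rewrite Aj setU11 in jA.
  have [jD|jD] := boolP (j \notin D); rewrite ?mul0r //=.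
  have [Aj|] := eqVneq A (j |: D); last by rewrite !mul0r.
  by rewrite Aj setU1K // eqxx in nD.
have [<-{j}|ij] := eqVneq i j => /=.
  rewrite /mode_coef setD11 /=.
  have [iA|iA] := boolP (i \in A); rewrite /= ?mul0r ?add0r ?mul1r ?addr0.
    by rewrite setD1K // mulrCA mode_signV mulr1 eq_sym.
  rewrite mulrCA; have [iB|iB] := boolP (i \in B); rewrite /= ?mul0r.
    by have [AB|//] := eqVneq A B; rewrite AB iB in iA.
  have -> : (i |: A == i |: B) = (A == B).
    by apply/eqP/eqP => [eAB|-> //]; rewrite -(setU1K iA) -(setU1K iB) eAB.
  by have [->|] := eqVneq A B; rewrite ?mode_signV ?mulr1 ?mul0r.
have [iA|iA] := boolP (i \in A).
  by rewrite !mul0r add0r /mode_coef !inE iA ij /= !mul0r mulr0.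
have [jA|jA] := boolP (j \in A); last first.
  rewrite !mul0r addr0 /mode_coef.
  have [jB|jB] := boolP (j \in B); rewrite /= ?mul0r ?mulr0 //.
  have [/setP/(_ j)|] := eqVneq (i |: A) (j |: B); last by rewrite mul0r mulr0.
  by rewrite !inE eqxx (negbTE jA) (eq_sym j) (negbTE ij).
rewrite /mode_coef !inE (negbTE iA) andbF /= !mul1r.
(* Only the case of j in A and i not in A is left; both terms then require B to be D plus i. *)
set D := A :\ j; have jD : j \notin D by rewrite setD11.
have iD : i \notin D by rewrite !inE (negbTE iA) andbF.
have AE : A = j |: D by rewrite setD1K.
move: D => D in iD jD AE *.
have jiD : j \notin i |: D by rewrite !inE negb_or eq_sym ij.
have -> : (j \notin B) && (i |: A == j |: B) = (B == i |: D).
  apply/andP/eqP => [[jB /eqP eAB]|->].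
    by rewrite -(setU1K jB) -eAB AE setUCA setU1K.
  by rewrite jiD setUCA -AE.
have [->|] := eqVneq B (i |: D); last by rewrite !mul0r !mulr0 addr0.
(* Relative to the signs taken on D, the first term gains one factor -1 from whichever of i and j is
   the smaller, and the second gains none. *)
rewrite !mul1r [in mode_sign i A]AE !mode_signU //.
have [ji|ij'|/val_inj/eqP] := ltngtP j i; last by rewrite eq_sym (negbTE ij).
  by rewrite expr0 expr1; ring.
by rewrite expr0 expr1; ring.
Qed.

Lemma annihilation_modeE i (a b : 'I_N) :
  (creation_mode C i)^t* a b = mode_coef i (occupied b) (occupied a).
Proof. by rewrite 2!mxE creation_modeE rmorphM rmorph_nat rmorphXn rmorphN1. Qed.

Lemma anticomm_mode i j :
  (creation_mode C i)^t* *m creation_mode C j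
    + creation_mode C j *m (creation_mode C i)^t* = (i == j)%:R%:M.
Proof.
apply/matrixP => a b; rewrite !mxE.
under eq_bigr => d _ do rewrite annihilation_modeE creation_modeE.
under [X in _ + X]eq_bigr => d _ do rewrite annihilation_modeE creation_modeE.
rewrite (sum_occupied (fun D => mode_coef i D _ * mode_coef j D _)).
rewrite (sum_occupied (fun D => mode_coef j _ D * mode_coef i _ D)).
by rewrite mode_anticomm (inj_eq occupied_inj); case: eqP; case: eqP.
Qed.

Lemma annihilationE (u : 'rV[C]_m) :
  annihilation u = \sum_i (u 0 i)^* *: (creation_mode C i)^t*.
Proof.
rewrite /annihilation /creation linear_sum rmorph_sum /=.
by apply: eq_bigr => i _; rewrite linearZ /= map_mxZ.
Qed.

Lemma anticomm (u v : 'rV[C]_m) :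
  annihilation u *m creation v + creation v *m annihilation u =
    ((v *m u^t*) 0 0)%:M.
Proof.
rewrite annihilationE /creation.
rewrite mulmx_suml; under eq_bigr => i _ do rewrite mulmx_sumr.
rewrite [X in _ + X]mulmx_suml.
under [X in _ + X]eq_bigr => i _ do rewrite mulmx_sumr.
rewrite [X in _ + X]exchange_big -big_split /= mxE [RHS]rmorph_sum /=.
apply: eq_bigr => i _; rewrite -big_split /= (bigD1 i) //=.
have E j : (u 0 i)^* *: (creation_mode C i)^t* *m (v 0 j *: creation_mode C j)
    + v 0 j *: creation_mode C j *m ((u 0 i)^* *: (creation_mode C i)^t*)
    = ((v 0 j * (u 0 i)^*) * (i == j)%:R)%:M.
  rewrite -!scalemxAl -!scalemxAr !scalerA [(u 0 i)^* * _]mulrC -scalerDr.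
  by rewrite anticomm_mode scale_scalar_mx.
rewrite E eqxx mulr1 big1 ?addr0 => [|j ji]; first by rewrite !mxE.
by rewrite E eq_sym (negbTE ji) mulr0 raddf0.
Qed.

Lemma annihilation_vacuum (u : 'rV[C]_m) : annihilation u *m vacuum C m = 0.
Proof.
rewrite annihilationE mulmx_suml big1 // => i _; rewrite -scalemxAl.
suff -> : (creation_mode C i)^t* *m vacuum C m = 0 by rewrite scaler0.
apply/matrixP => a b; rewrite !mxE big1 // => d _.
rewrite annihilation_modeE mxE; have [->|] := eqVneq; last by rewrite mulr0.
rewrite /mode_coef; have [/setP/(_ i)|] := eqVneq set0 _.
  by rewrite !inE eqxx.
by rewrite andbF !mul0r.
Qed.

Lemma vacuum_norm : (vacuum C m)^t* *m vacuum C m = 1%:M.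
Proof.
apply/matrixP => a b; rewrite !ord1 !mxE eqxx /=.
under eq_bigr => d _ do rewrite !mxE rmorph_nat -natrM mulnb andbb.
rewrite (sum_occupied (fun D => (D == set0)%:R)) (bigD1 set0) //= eqxx.
by rewrite big1 ?addr0 // => D /negbTE->.
Qed.

End Fock.

(** * Contractions and Gram determinants of wedge products *)

Section Wedge.
Variables (C : numClosedFieldType) (m : nat).
Local Notation N := (fock_dim m).

Lemma wedgeS n (psi : 'M[C]_(n.+1, m)) :
  wedge psi = creation (row ord0 psi) *m wedge (row' ord0 psi).
Proof.
rewrite /wedge big_ord_recl -mulmxA; congr (_ *m (_ *m _)).
by apply: eq_bigr => j _; congr creation; apply/rowP => i; rewrite !mxE.
Qed.

Lemma wedge0 (psi : 'M[C]_(0, m)) : wedge psi = vacuum C m.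
Proof. by rewrite /wedge big_ord0 mul1mx. Qed.

Lemma annihilation_wedge0 (u : 'rV[C]_m) (psi : 'M[C]_(0, m)) :
  annihilation u *m wedge psi = 0.
Proof. by rewrite wedge0 annihilation_vacuum. Qed.

(** Contraction is an antiderivation: [anticomm] moves the annihilator past the first creation
    operator at the price of a sign, and the induction hypothesis handles the remaining factors. *)
Lemma annihilation_wedge n (u : 'rV[C]_m) (psi : 'M[C]_(n.+1, m)) :
  annihilation u *m wedge psi =
    \sum_(k < n.+1) ((-1) ^+ k * (psi *m u^t*) k 0) *: wedge (row' k psi).
Proof.
elim: n psi => [|n IH] psi.
  rewrite wedgeS mulmxA big_ord1 expr0 mul1r.
  have := anticomm u (row ord0 psi).
  move=> /(congr1 (fun M => M *m wedge (row' ord0 psi))).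
  rewrite mulmxDl -[_ *m _ *m wedge _ in X in _ + X]mulmxA annihilation_wedge0.
  by rewrite mulmx0 addr0 mul_scalar_mx -row_mul mxE.
rewrite wedgeS mulmxA.
have := anticomm u (row ord0 psi).
move=> /(canRL (addrK _)) ->; rewrite mulmxBl -mulmxA IH mul_scalar_mx.
rewrite [RHS]big_ord_recl -row_mul mxE expr0 mul1r; congr (_ + _).
rewrite mulmx_sumr -sumrN; apply: eq_bigr => k _.
rewrite -scalemxAr -scaleNr; congr (_ *: _).
  by rewrite lift0 exprS mulN1r -mulNr; congr (_ * _); rewrite !mxE;
    apply: eq_bigr => i _; rewrite !mxE.
(* Deleting row 0 and then row k is the same as deleting row k + 1 and then row 0. *)
rewrite wedgeS. congr (_ *m _); [congr creation|congr wedge].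
  by apply/rowP => i; rewrite !mxE; congr (psi _ _); apply: val_inj.
apply/matrixP => i j; rewrite !mxE; congr (psi _ _); apply: val_inj.
by rewrite /= /bump !leq0n !add1n ltnS addnS.
Qed.

Lemma wedge_minor n (phi psi : 'M[C]_(n.+1, m)) (k l : 'I_n.+1) :
  row' k psi *m (row' l phi)^t* = row' k (col' l (psi *m phi^t*)).
Proof.
by apply/matrixP => i j; rewrite !mxE; apply: eq_bigr => h _; rewrite !mxE.
Qed.

(** Contracting with the first row of phi reproduces the Laplace expansion of the determinant along
    its first column. *)
Lemma wedge_gram n (phi psi : 'M[C]_(n, m)) :
  (wedge phi)^t* *m wedge psi = (\det (psi *m phi^t*))%:M.
Proof.
elim: n phi psi => [|n IH] phi psi.
  by rewrite !wedge0 vacuum_norm det_mx00.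
rewrite (wedgeS phi) trmx_mul map_mxM -mulmxA annihilation_wedge.
rewrite (expand_det_col _ ord0) mulmx_sumr rmorph_sum /=; apply: eq_bigr => k _.
rewrite -scalemxAr IH scale_scalar_mx; congr _%:M.
rewrite /cofactor addn0 [RHS]mulrCA [RHS]mulrA -wedge_minor; congr (_ * _ * _).
by rewrite !mxE; apply: eq_bigr => i _; rewrite !mxE.
Qed.

Lemma annihilation_occupied n (g : 'M[C]_(n.+1, m)) (mu : 'I_n.+1) :
  g \is unitarymx ->
  annihilation (row mu g) *m wedge g = (-1) ^+ mu *: wedge (row' mu g).
Proof.
move=> /unitarymxP gg; rewrite annihilation_wedge.
have E k : (g *m (row mu g)^t*) k 0 = (k == mu)%:R.
  by move/matrixP: gg => /(_ k mu); rewrite !mxE => <-; apply: eq_bigr => i _;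
    rewrite !mxE.
rewrite (bigD1 mu) //= E eqxx mulr1 big1 ?addr0 // => k /negbTE kmu.
by rewrite E kmu mulr0 scale0r.
Qed.

Lemma annihilation_ortho n (g : 'M[C]_(n, m)) (u : 'rV[C]_m) :
  g *m u^t* = 0 -> annihilation u *m wedge g = 0.
Proof.
case: n g => [|n] g gu; first exact: annihilation_wedge0.
rewrite annihilation_wedge big1 // => k _.
by rewrite gu mxE mulr0 scale0r.
Qed.

Lemma creation_adj (u : 'rV[C]_m) : (creation u)^t* = annihilation u.
Proof. by []. Qed.

(** Removing g_mu from G and contracting psi with v leaves Gram determinants of size one less. With
    their signs these are the cofactors of psi g^*, that is, the entries of its adjugate. *)
Lemma hole_gram n (g psi : 'M[C]_(n, m)) (v : 'rV[C]_m) (mu : 'I_n) :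
  g \is unitarymx ->
  (creation v *m annihilation (row mu g) *m wedge g)^t* *m wedge psi =
    ((\adj (psi *m g^t*) *m (psi *m v^t*)) mu 0)%:M.
Proof.
case: n g psi mu => [|n] g psi mu gg; first by case: mu.
rewrite -mulmxA annihilation_occupied // adjM creation_adj -mulmxA.
rewrite annihilation_wedge adjZ rmorphXn rmorphN1 -scalemxAl.
rewrite mulmx_sumr scaler_sumr mxE rmorph_sum /=; apply: eq_bigr => k _.
rewrite -scalemxAr wedge_gram !scale_scalar_mx wedge_minor [\adj _ _ _]mxE /cofactor.
by congr _%:M; rewrite exprD; ring.
Qed.

Lemma hole_hole_gram n (g : 'M[C]_(n, m)) (mu nu : 'I_n) :
  g \is unitarymx ->
  (annihilation (row mu g) *m wedge g)^t* *m (annihilation (row nu g) *m wedge g)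
   = (mu == nu)%:R%:M.
Proof.
case: n g mu nu => [|n] g mu nu gg; first by case: mu.
rewrite !annihilation_occupied // adjZ rmorphXn rmorphN1 -scalemxAl -scalemxAr.
rewrite wedge_gram !scale_scalar_mx wedge_minor (unitarymxP gg).
(* The signed minors of the identity are the entries of its adjugate, which is again the
   identity. *)
have := mul_mx_adj (1%:M : 'M[C]_n.+1); rewrite det1 mul1mx => /matrixP/(_ mu nu).
by rewrite !mxE /cofactor exprD -mulrA mulrCA => ->.
Qed.

End Wedge.

(** * Single particle-hole excitations *)

Section Excitations.
Variables (C : numClosedFieldType) (m n p : nat).
Variables (g : 'M[C]_(n, m)) (f : 'M[C]_(p, m)).
Hypotheses (gg : g \is unitarymx) (ff : f \is unitarymx) (fg : f *m g^t* = 0).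
Local Notation N := (fock_dim m).

Lemma excitation_wedge (psi : 'M[C]_(n, m)) a mu :
  (excitation g f a mu)^t* *m wedge psi =
    ((\adj (psi *m g^t*) *m (psi *m f^t*)) mu a)%:M.
Proof.
rewrite /excitation hole_gram //; congr _%:M; rewrite !mxE.
by apply: eq_bigr => k _; congr (_ * _); rewrite !mxE; apply: eq_bigr => i _;
  rewrite !mxE.
Qed.

Lemma occupied_unoccupied_ortho : g *m f^t* = 0.
Proof. by rewrite -[g]trmxCK -adjM fg trmx0 raddf0. Qed.

Lemma excitation_ground a mu : (excitation g f a mu)^t* *m wedge g = 0.
Proof. by rewrite excitation_wedge occupied_unoccupied_ortho mulmx0 mxE raddf0. Qed.

(** Anticommuting c_{f_a} past c_{f_b}^dag yields the overlap of f_a and f_b times that of the two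
    hole states; the other term dies because f_a is orthogonal to every occupied orbital. *)
Lemma excitation_orthonormal a mu b nu :
  (excitation g f a mu)^t* *m excitation g f b nu =
    ((a == b) && (mu == nu))%:R%:M.
Proof.
rewrite /excitation -!mulmxA adjM creation_adj -!mulmxA.
rewrite [annihilation (row a f) *m _]mulmxA.
have /(canRL (addrK _)) -> := anticomm (row a f) (row b f).
rewrite mulmxBl mulmxBr mul_scalar_mx -scalemxAr hole_hole_gram //.
rewrite -[creation _ *m _ *m _]mulmxA.
have -> : annihilation (row a f) *m (annihilation (row nu g) *m wedge g) = 0.
  case: (n) g gg occupied_unoccupied_ortho nu => [|n'] g' gg' gf' nu'.
    by case: nu'.
  rewrite annihilation_occupied // -scalemxAr annihilation_ortho ?scaler0 //.
  apply/matrixP => i j; move/matrixP: gf' => /(_ (lift nu' i) a).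
  by rewrite !mxE => E; rewrite -[RHS]E; apply: eq_bigr => k _; rewrite !mxE.
rewrite !mulmx0 subr0 scale_scalar_mx.
have -> : (row b f *m (row a f)^t*) 0 0 = (a == b)%:R.
  move/unitarymxP: ff => /matrixP/(_ b a); rewrite !mxE eq_sym => <-.
  by apply: eq_bigr => i _; rewrite !mxE.
by case: eqP; case: eqP; rewrite ?mulr1 ?mulr0.
Qed.

End Excitations.

(** * Positive operators and orthogonal projectors *)

Section Hilbert.
Variables (C : numClosedFieldType) (N : nat).
Implicit Types (u v w : 'cV[C]_N) (M P : 'M[C]_N).

Definition dot u v : C := (u^t* *m v) 0 0.

Lemma dotDr u v w : dot u (v + w) = dot u v + dot u w.
Proof. by rewrite /dot mulmxDr mxE. Qed.

Lemma dotZr x u v : dot u (x *: v) = x * dot u v.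
Proof. by rewrite /dot -scalemxAr mxE. Qed.

Lemma dotNr u v : dot u (- v) = - dot u v.
Proof. by rewrite /dot mulmxN mxE. Qed.

Lemma dot_conj u v : (dot u v)^* = dot v u.
Proof.
have -> : dot v u = ((u^t* *m v)^t*) 0 0 by rewrite adjM trmxCK.
by rewrite [RHS]mxE [in RHS]mxE.
Qed.

Lemma dotDl u v w : dot (u + v) w = dot u w + dot v w.
Proof. by rewrite -dot_conj dotDr rmorphD /= !dot_conj. Qed.

Lemma dotZl x u v : dot (x *: u) v = x^* * dot u v.
Proof. by rewrite -dot_conj dotZr rmorphM /= !dot_conj. Qed.

Lemma dotNl u v : dot (- u) v = - dot u v.
Proof. by rewrite -dot_conj dotNr rmorphN /= !dot_conj. Qed.

Lemma dot_suml (I : finType) (F : I -> 'cV[C]_N) v :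
  dot (\sum_i F i) v = \sum_i dot (F i) v.
Proof.
have d0 : dot 0 v = 0 by rewrite -(scale0r 0) dotZl rmorph0 mul0r.
by apply: (big_morph (dot^~ v) _ d0) => x y; exact: dotDl.
Qed.

Lemma dot_sumr (I : finType) (F : I -> 'cV[C]_N) v :
  dot v (\sum_i F i) = \sum_i dot v (F i).
Proof.
rewrite -dot_conj dot_suml rmorph_sum /=; apply: eq_bigr => i _.
exact: dot_conj.
Qed.

Lemma dot_adjr M u v : dot u (M *m v) = dot (M^t* *m u) v.
Proof. by rewrite /dot adjM trmxCK mulmxA. Qed.

Lemma dot_ge0 u : 0 <= dot u u.
Proof.
rewrite /dot mxE sumr_ge0 // => i _; rewrite !mxE mulrC.
exact: mul_conjC_ge0.
Qed.

Lemma dot_eq0 u : (dot u u == 0) = (u == 0).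
Proof.
apply/eqP/eqP => [|->]; last by rewrite /dot mulmx0 mxE.
rewrite /dot mxE => /eqP; rewrite psumr_eq0 => [/allP u0|i _]; last first.
  by rewrite !mxE mulrC mul_conjC_ge0.
apply/colP => i; rewrite mxE; apply/eqP.
have := u0 i (mem_index_enum i).
by rewrite !mxE mulrC mul_conjC_eq0.
Qed.

Lemma psd_cauchy_schwarz M u v :
    M^t* = M -> (forall w, 0 <= dot w (M *m w)) ->
  `|dot u (M *m v)| ^+ 2 <= dot u (M *m u) * dot v (M *m v).
Proof.
move=> hM M0; set s := dot u (M *m v).
have sE : dot v (M *m u) = s^* by rewrite dot_conj -[in LHS]hM dot_adjr trmxCK.
have M0xy x y : 0 <= `|x| ^+ 2 * dot u (M *m u) - (x^* * y * s)
    - (x^* * y * s)^* + `|y| ^+ 2 * dot v (M *m v).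
  have := M0 (x *: u - y *: v).
  rewrite mulmxBr -!scalemxAr !dotDl !dotDr !(dotNl, dotNr, dotZl, dotZr) sE -/s.
  congr (0 <= _); rewrite !normCK !rmorphM /= conjCK; ring.
move: (M0 u) (M0 v) M0xy.
move: (dot u _) (dot v _) => a b a0 b0 M0xy.
have [b00|bn0] := eqVneq b 0.
  have [->|sn0] := eqVneq s 0; first by rewrite normr0 expr0n /= mulr_ge0.
  have ac : a^* = a by exact: geC0_conj.
  (* With b = 0 and s nonzero the form is affine in y; this y gives it the value -1, a
     contradiction. *)
  have := M0xy 1 ((a + 1) / (2 * `|s| ^+ 2) * s^*).
  rewrite b00 mulr0 addr0 normr1 expr1n mul1r rmorph1 mul1r.
  rewrite -mulrA [s^* * s]mulrC -normCK.
  have -> : (a + 1) / (2 * `|s| ^+ 2) * `|s| ^+ 2 = (a + 1) / 2.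
    by field; rewrite normr_eq0 sn0.
  rewrite fmorph_div rmorphD rmorph1 /= ac rmorph_nat.
  have -> : a - (a + 1) / 2 - (a + 1) / 2 = -1 by field.
  by rewrite oppr_ge0 ler10.
have bgt0 : 0 < b by rewrite lt_def bn0.
have bc : b^* = b by exact: geC0_conj.
(* The minimizing ratio y / x = s^* / b, cleared of its denominator. *)
have := M0xy b s^*; rewrite bc -mulrA [s^* * s]mulrC -normCK norm_conjC.
rewrite rmorphM rmorphXn /= conj_normC bc (ger0_norm b0).
have -> : b ^+ 2 * a - b * `|s| ^+ 2 - b * `|s| ^+ 2 + `|s| ^+ 2 * b =
   b * (a * b - `|s| ^+ 2) by ring.
by rewrite pmulr_rge0 // subr_ge0.
Qed.

Lemma cauchy_schwarz u v : `|dot u v| ^+ 2 <= dot u u * dot v v.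
Proof.
have := @psd_cauchy_schwarz 1%:M u v; rewrite !mul1mx; apply.
  by rewrite trmx1 map_mx1.
by move=> w; rewrite mul1mx dot_ge0.
Qed.

(** In an eigenbasis all eigenvalues are nonnegative, so each is at most their sum. *)
Lemma psd_le_trace M w :
    M^t* = M -> (forall u, 0 <= dot u (M *m u)) ->
  dot w (M *m w) <= dot w w * \tr M.
Proof.
move=> hM M0; set U := spectralmx M; set d := spectral_diag M.
have UU : U \is unitarymx by exact: spectral_unitarymx.
have UUV : U *m U^t* = 1%:M by exact/unitarymxP.
have VU : U^t* *m U = 1%:M by exact: mulmx1C.
have /orthomx_spectralP : M \is normalmx by apply/normalmxP; rewrite hM.
rewrite -/U -/d invmx_unitary // => ME.
have UMU : U *m M *m U^t* = diag_mx d.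
  by rewrite ME !mulmxA UUV mul1mx -mulmxA UUV mulmx1.
have d0 i : 0 <= d 0 i.
  have := M0 ((row i U)^t*); rewrite /dot trmxCK.
  congr (0 <= _); transitivity ((U *m (M *m U^t*)) i i); last first.
    by rewrite mulmxA UMU mxE eqxx.
  rewrite !mxE; apply: eq_bigr => k _; rewrite !mxE; congr (_ * _).
  by apply: eq_bigr => l _; rewrite !mxE.
have -> : dot w (M *m w) = \sum_i d 0 i * `|(U *m w) i 0| ^+ 2.
  have -> : M *m w = U^t* *m (diag_mx d *m (U *m w)) by rewrite ME !mulmxA.
  rewrite dot_adjr trmxCK /dot mxE; apply: eq_bigr => i _.
  by rewrite mul_diag_mx !mxE normCK; ring.
have -> : \tr M = \sum_i d 0 i.
  by rewrite -mxtrace_diag -UMU mxtrace_mulC mulmxA VU mul1mx.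
have -> : dot w w = \sum_i `|(U *m w) i 0| ^+ 2.
  transitivity (dot (U *m w) (U *m w)).
    by rewrite dot_adjr mulmxA VU mul1mx.
  by rewrite /dot mxE; apply: eq_bigr => i _; rewrite !mxE mulrC normCK.
rewrite mulr_sumr ler_sum // => i _; rewrite mulrC ler_wpM2r //.
by rewrite (bigD1 i) //= lerDl sumr_ge0 // => j _; rewrite exprn_ge0.
Qed.

(** The deflated operator [S] is positive by Cauchy-Schwarz for the form of M, so [psd_le_trace]
    applies to it; the rank-one part that was removed gives the first summand. *)
Lemma psd_le_deflated M G w :
    M^t* = M -> (forall u, 0 <= dot u (M *m u)) -> 0 < dot G (M *m G) ->
  dot w (M *m w) <= `|dot w (M *m G)| ^+ 2 / dot G (M *m G)
    + dot w w * (\tr M - dot (M *m G) (M *m G) / dot G (M *m G)).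
Proof.
move=> hM M0; set al := dot G _ => al0.
set S := M - al^-1 *: ((M *m G) *m (M *m G)^t*).
have alc : al^* = al by apply: geC0_conj; exact: ltW.
have Sw u : dot u (S *m u) = dot u (M *m u) - `|dot u (M *m G)| ^+ 2 / al.
  rewrite /S mulmxBl -scalemxAl -(mulmxA (M *m G)) dotDr dotNr dotZr; congr (_ - _).
  rewrite mulrC; congr (_ / _).
  have -> : (M *m G)^t* *m u = (dot (M *m G) u)%:M by exact: mx11_scalar.
  by rewrite mul_mx_scalar dotZr mulrC normCK dot_conj.
have hS : S^t* = S.
  rewrite /S !raddfB /= hM; congr (_ - _).
  rewrite adjZ adjM trmxCK; congr (_ *: _).
  by rewrite fmorphV /= alc.
have S0 u : 0 <= dot u (S *m u).
  by rewrite Sw subr_ge0 ler_pdivrMr // psd_cauchy_schwarz.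
have := psd_le_trace w hS S0.
rewrite Sw lerBlDl; congr (_ <= _ + _ * _).
rewrite /S raddfB /=; congr (_ - _).
rewrite linearZ /= mulrC; congr (_ / _).
by rewrite mxtrace_mulC trace_mx11.
Qed.

Lemma add_conj_le (z : C) : z + z^* <= 2 * `|z|.
Proof.
have -> : z + z^* = 2 * 'Re z by rewrite ReE; field.
rewrite ler_pM2l ?ltr0n //.
apply: le_trans (leif_normC_Re_Creal z); apply: real_ler_norm.
exact: Creal_Re.
Qed.

(** As rho G = al G + r with w orthogonal to G, the cross terms of <H|rho|H> are twice the real part
    of c^* <r|w>; the term <w|rho|w> is bounded by deflation along G. *)
Lemma density_expansion (rho : 'M[C]_N) (G H w r : 'cV[C]_N) (al c : C) :
    rho^t* = rho -> (forall u, 0 <= dot u (rho *m u)) -> \tr rho = 1 ->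
    dot G G = 1 -> 0 < al ->
    al = dot G (rho *m G) -> c = dot G H ->
    w = H - c *: G -> r = rho *m G - al *: G ->
  dot H (rho *m H) <= `|c| ^+ 2 * al + 2 * (`|c| * `|dot r w|)
    + (`|dot r w| ^+ 2 / al + dot w w * (1 - (al ^+ 2 + dot r r) / al)).
Proof.
move=> hrho rho0 tr1 GG al0 alE cE wE rE.
have HE : H = c *: G + w by rewrite wE addrC subrK.
have rhoE : rho *m G = al *: G + r by rewrite rE addrC subrK.
have alc : al^* = al by apply: geC0_conj; exact: ltW.
have Gw : dot G w = 0 by rewrite wE dotDr dotNr dotZr GG mulr1 cE subrr.
have Gr : dot G r = 0 by rewrite rE dotDr dotNr dotZr GG mulr1 -alE subrr.
have wr : dot w (rho *m G) = (dot r w)^*.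
  by rewrite rhoE dotDr dotZr -[dot w G]dot_conj Gw rmorph0 mulr0 add0r dot_conj.
have rhoGG : dot (rho *m G) (rho *m G) = al ^+ 2 + dot r r.
  rewrite rhoE dotDl !dotDr !dotZl !dotZr GG Gr -[dot r G]dot_conj Gr rmorph0.
  by rewrite alc; ring.
have -> : dot H (rho *m H) = `|c| ^+ 2 * al
    + (c^* * dot r w + (c^* * dot r w)^*) + dot w (rho *m w).
  rewrite HE mulmxDr -scalemxAr dotDl !dotDr !dotZl !dotZr wr -alE.
  rewrite [dot G (rho *m w)]dot_adjr hrho -[dot (rho *m G) w]dot_conj wr conjCK.
  by rewrite rmorphM /= conjCK normCK; ring.
apply: lerD; first apply: lerD => //.
  by apply: le_trans (add_conj_le _) _; rewrite normrM norm_conjC.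
have := psd_le_deflated (G := G) w hrho rho0; rewrite -alE => /(_ al0).
by rewrite wr norm_conjC tr1 rhoGG.
Qed.

Section Projector.
Variables (P : 'M[C]_N) (hP : P^t* = P) (PP : P *m P = P).

Lemma dot_projl u v : dot (P *m u) v = dot (P *m u) (P *m v).
Proof. by rewrite [RHS]dot_adjr hP mulmxA PP. Qed.

Lemma dot_proj_split u v :
  dot u v = dot (P *m u) (P *m v) + dot (u - P *m u) (v - P *m v).
Proof.
have E x y : dot (P *m x) (y - P *m y) = 0.
  by rewrite dot_projl mulmxBr mulmxA PP subrr -(scale0r 0) dotZr mul0r.
have E' x y : dot (x - P *m x) (P *m y) = 0 by rewrite -dot_conj E rmorph0.
transitivity (dot (P *m u + (u - P *m u)) (P *m v + (v - P *m v))).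
  by rewrite ![P *m _ + _]addrC !subrK.
move: (E u v) (E' u v); move: (u - _) (v - _) => x y Exy Eyx.
by rewrite dotDl !dotDr Exy Eyx addr0 add0r.
Qed.

(** The E_i lie in the range of P, so they have the same inner products with u and with P u; the
    squared norm of P u minus its expansion [S] is nonnegative. *)
Lemma bessel (I : finType) (E : I -> 'cV[C]_N) u :
    (forall i, P *m E i = E i) -> (forall i j, dot (E i) (E j) = (i == j)%:R) ->
  \sum_i `|dot (E i) u| ^+ 2 <= dot (P *m u) (P *m u).
Proof.
move=> PE EE; set K := \sum_i _; set S := \sum_i dot (E i) u *: E i.
have EPu i : dot (E i) (P *m u) = dot (E i) u by rewrite dot_adjr hP PE.
have SK : dot (P *m u) S = K.
  rewrite dot_sumr; apply: eq_bigr => i _.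
  by rewrite dotZr -[dot (P *m u) _]dot_conj EPu normCK.
have KS : dot S (P *m u) = K.
  rewrite -dot_conj SK rmorph_sum /=; apply: eq_bigr => i _.
  by rewrite geC0_conj // exprn_ge0.
have SS : dot S S = K.
  rewrite {1}/S dot_suml; apply: eq_bigr => i _.
  rewrite dotZl dot_sumr (bigD1 i) //= dotZr EE eqxx mulr1 big1 => [|j ji].
    by rewrite addr0 normCK mulrC.
  by rewrite dotZr EE eq_sym (negbTE ji) mulr0.
have := dot_ge0 (P *m u - S); rewrite dotDl !dotDr !(dotNl, dotNr) SK KS SS.
by rewrite opprK addNr addr0 subr_ge0.
Qed.

End Projector.

(** The range of 1 - Q is orthogonal to that of Q, so Q^* = Q Q^*, which is self-adjoint. *)
Lemma proj_ortho_adj n (U : 'M[C]_(n, N)) : (proj_ortho U)^t* = proj_ortho U.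
Proof.
set Q := proj_ortho U.
have QU : (Q <= U)%MS by rewrite -[Q]mul1mx proj_ortho_sub.
have := proj_ortho_compl_sub U (1%:M : 'M_N); rewrite mul1mx -/Q => Qc.
have E : (1%:M - Q) *m Q^t* = 0.
  have /submxP[D QD] := QU.
  have -> : Q^t* = U^t* *m D^t* by rewrite [in LHS]QD adjM.
  rewrite mulmxA.
  by have /orthomx1P -> := Qc; rewrite mul0mx.
have QQ : Q^t* = Q *m Q^t*.
  by apply/eqP; rewrite -subr_eq0 -{1}[Q^t*]mul1mx -mulmxBl E.
by rewrite -[RHS]trmxCK QQ [RHS]adjM trmxCK.
Qed.

Lemma proj_ortho_orth_eq0 p n (U : 'M[C]_(n, N)) (W : 'M[C]_(p, N)) :
  U *m W^t* = 0 -> W *m proj_ortho U = 0.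
Proof.
move=> UW; rewrite -[LHS]trmxCK (adjM W) proj_ortho_adj.
have /submxP[D ->] : (proj_ortho U <= U)%MS.
  by rewrite -[proj_ortho U]mul1mx proj_ortho_sub.
by rewrite -mulmxA UW mulmx0 trmx0 raddf0.
Qed.

End Hilbert.

(** * The scalar inequalities *)

Section RealBounds.
Variable R : rcfType.

(** Here c = |<G|H>| and s = |<r|w>|, with a, b, p, q the norms of the components of w and r inside
    and outside the range of the projector. The hypothesis [key] is the constraint imposed by Slater
    determinants. *)
Lemma slater_real_bound (al c a b p q s : R) :
    0 < al -> 0 <= c -> 0 <= a -> 0 <= b -> 0 <= p -> 0 <= q ->
    c ^+ 2 + (a ^+ 2 + b ^+ 2) = 1 -> s <= a * p + b * q -> 0 <= s ->
    2 * (c ^+ 2 * (1 - c ^+ 2)) <= a ^+ 2 * (1 + c ^+ 2) ->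
  c ^+ 2 * al + 2 * (c * s) + (s ^+ 2 / al
    + (a ^+ 2 + b ^+ 2) * (1 - (al ^+ 2 + (p ^+ 2 + q ^+ 2)) / al))
  <= al - (3 * al / 2 - 1) * (1 - c ^+ 2) + 2 * p * Num.sqrt (1 - c ^+ 2).
Proof.
move=> al0 c0 a0 b0 p0 q0 norm1 sab s0 key.
have xE : 1 - c ^+ 2 = a ^+ 2 + b ^+ 2 by rewrite -norm1 addrAC subrr add0r.
have x0 : 0 <= a ^+ 2 + b ^+ 2 by rewrite addr_ge0 // sqr_ge0.
rewrite xE; set y := Num.sqrt _.
have y0 : 0 <= y by exact: sqrtr_ge0.
have y2 : y ^+ 2 = a ^+ 2 + b ^+ 2 by rewrite sqr_sqrtr.
set h := Num.sqrt (2 : R).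
have h0 : 0 <= h by exact: sqrtr_ge0.
have h2 : h ^+ 2 = 2 by rewrite sqr_sqrtr.
(* Squared, and with b^2 = 1 - c^2 - a^2, this is exactly [key]. *)
have hcb : h * (c * b) <= a * y.
  rewrite -ler_sqr ?nnegrE ?mulr_ge0 // !exprMn h2 y2.
  have : b ^+ 2 = (a ^+ 2 + b ^+ 2) - a ^+ 2 by ring.
  rewrite -xE; move: (c ^+ 2) (a ^+ 2) key => c2 a2 key ->; lra.
(* Cauchy-Schwarz in the plane, through the Lagrange identity: the square is at most (4 c^2 + 2 y^2)
   y^2 = (4 - 2 y^2) y^2. *)
have cay : 2 * (c * a) + h * (y * b) <= 2 * y.
  have t0 : 0 <= 2 * (c * a) + h * (y * b) by rewrite addr_ge0 ?mulr_ge0.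
  rewrite -ler_sqr ?nnegrE ?mulr_ge0 //.
  have : (2 * (c * a) + h * (y * b)) ^+ 2 + (2 * (c * b) - h * (y * a)) ^+ 2
       = (4 * c ^+ 2 + h ^+ 2 * y ^+ 2) * (a ^+ 2 + b ^+ 2) by ring.
  rewrite h2 -y2.
  have := sqr_ge0 (2 * (c * b) - h * (y * a)).
  have : c ^+ 2 = 1 - y ^+ 2 by rewrite y2 -xE; ring.
  have : 0 <= (y ^+ 2) ^+ 2 by exact: sqr_ge0.
  rewrite [(2 * y) ^+ 2]exprMn; move: (_ ^+ 2) (_ ^+ 2) (y ^+ 2) (c ^+ 2).
  move=> t1 t2 y2' c2 t3 -> t4 t5; nra.
have amgm e : h * (y * e) <= al * y ^+ 2 / 2 + e ^+ 2 / al.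
  rewrite -subr_ge0 (_ : _ - _ = al / 2 * (y - h * e / al) ^+ 2).
    by rewrite mulr_ge0 ?divr_ge0 ?sqr_ge0 // ltW.
  have -> : e ^+ 2 / al = h ^+ 2 * (e ^+ 2 / al) / 2 by rewrite h2; field; lra.
  by field; lra.
(* The left side increases with s, so s may be replaced by its upper bound. *)
have mono : 2 * (c * s) + s ^+ 2 / al <=
    2 * (c * (a * p + b * q)) + (a * p + b * q) ^+ 2 / al.
  apply: lerD; first by rewrite ler_pM2l // ler_wpM2l.
  apply: ler_wpM2r; first by rewrite invr_ge0 ltW.
  by rewrite ler_sqr ?nnegrE // (le_trans s0).
apply: le_trans (_ : c ^+ 2 * al + (2 * (c * (a * p + b * q))
   + (a * p + b * q) ^+ 2 / al)
   + (a ^+ 2 + b ^+ 2) * (1 - (al ^+ 2 + (p ^+ 2 + q ^+ 2)) / al) <= _).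
  by rewrite -[X in X <= _]addrA addrA -!addrA lerD2l !addrA lerD2r.
have cE : c ^+ 2 = 1 - (a ^+ 2 + b ^+ 2) by rewrite -xE; ring.
rewrite -subr_ge0 cE.
(* The Lagrange identity turns (a^2 + b^2) (p^2 + q^2) - (a p + b q)^2 into (a q - b p)^2. *)
have -> : al - (3 * al / 2 - 1) * (a ^+ 2 + b ^+ 2) + 2 * p * y -
  ((1 - (a ^+ 2 + b ^+ 2)) * al
   + (2 * (c * (a * p + b * q)) + (a * p + b * q) ^+ 2 / al)
   + (a ^+ 2 + b ^+ 2) * (1 - (al ^+ 2 + (p ^+ 2 + q ^+ 2)) / al)) =
  al * (a ^+ 2 + b ^+ 2) / 2 + (a * q - b * p) ^+ 2 / al + 2 * p * y
   - 2 * (c * (a * p + b * q)) by field; lra.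
rewrite -y2.
(* Adding h q times [hcb], p times [cay] and this instance of AM-GM cancels the terms h y a q and h
   y b p. *)
have := amgm (a * q - b * p).
have := ler_wpM2r q0 (ler_wpM2l h0 hcb).
have := ler_wpM2r p0 cay.
have -> : h * (h * (c * b)) * q = 2 * (c * b * q) by rewrite -h2; ring.
move: (_ / al) (al * _ / 2) => t1 t2.
lra.
Qed.

Lemma quadratic_opt (k r y : R) : 0 < k -> - k * y ^+ 2 + 2 * r * y <= r ^+ 2 / k.
Proof.
move=> k0; rewrite -subr_ge0 (_ : _ - _ = (r - k * y) ^+ 2 / k).
  by rewrite divr_ge0 ?sqr_ge0 // ltW.
by field; lra.
Qed.

End RealBounds.

(** * The weight of a Slater determinant on the single excitations *)

Section ExcitationProj.
Variables (C : numClosedFieldType) (m n p : nat).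
Variables (g : 'M[C]_(n, m)) (f : 'M[C]_(p, m)).
Hypotheses (gg : g \is unitarymx) (ff : f \is unitarymx) (fg : f *m g^t* = 0).
Local Notation P := (excitation_proj g f).

Lemma excitation_proj_adj : P^t* = P.
Proof. by rewrite /excitation_proj trmxK -[in RHS]proj_ortho_adj map_trmx trmxK. Qed.

Lemma excitation_proj_idem : P *m P = P.
Proof. by rewrite /excitation_proj -trmx_mul proj_ortho_proj. Qed.

Lemma excitation_proj_id a mu : P *m excitation g f a mu = excitation g f a mu.
Proof.
rewrite /excitation_proj -[excitation g f a mu in LHS]trmxK -trmx_mul.
rewrite proj_ortho_id ?trmxK //.
by apply: (sumsmx_sup a) => //; apply: (sumsmx_sup mu) => //; rewrite genmxE.
Qed.

Lemma excitation_proj_ground : P *m wedge g = 0.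
Proof.
rewrite /excitation_proj -[wedge g]trmxK -trmx_mul proj_ortho_orth_eq0 ?trmx0 //.
apply/sub_kermxP/sumsmx_subP => a _; apply/sumsmx_subP => mu _; rewrite genmxE.
apply/sub_kermxP; have := excitation_ground gg fg a mu.
move=> /(congr1 (map_mx Num.conj)); rewrite raddf0 map_mxM trmxK.
by move=> <-; congr (_ *m _); apply/matrixP => i j; rewrite !mxE /= conjCK.
Qed.

Lemma wedge_norm (psi : 'M[C]_(n, m)) : psi \is unitarymx ->
  dot (wedge psi) (wedge psi) = 1.
Proof. by move=> /unitarymxP pp; rewrite /dot wedge_gram pp det1 mxE. Qed.

(** The stacked orbitals form a square matrix with orthonormal rows, hence with orthonormal
    columns. *)
Lemma orbitals_complete : (n + p)%N = m -> g^t* *m g + f^t* *m f = 1%:M.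
Proof.
move=> npm; subst m.
have gf0 : g *m f^t* = 0 by exact: occupied_unoccupied_ortho.
have U : col_mx g f *m (col_mx g f)^t* = 1%:M.
  rewrite tr_col_mx map_row_mx mul_col_row fg gf0 (unitarymxP gg) (unitarymxP ff).
  by rewrite -scalar_mx_block.
by have := mulmx1C U; rewrite tr_col_mx map_row_mx mul_row_col.
Qed.

(** Completeness of the orbitals gives the blocks psi g^* and psi f^* the normalization that
    [cofactor_block] asks for. Its trace is the sum of the squared excitation amplitudes, bounded
    through [bessel]. *)
Lemma excitation_weight (psi : 'M[C]_(n, m)) :
    (n + p)%N = m -> psi \is unitarymx ->
  2 * (`|dot (wedge g) (wedge psi)| ^+ 2
        * (1 - `|dot (wedge g) (wedge psi)| ^+ 2))
    <= dot (P *m wedge psi) (P *m wedge psi)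
        * (1 + `|dot (wedge g) (wedge psi)| ^+ 2).
Proof.
move=> npm pp; set c2 := `|_| ^+ 2; set A := psi *m g^t*; set B := psi *m f^t*.
have c2E : c2 = `|\det A| ^+ 2 by rewrite /c2 /dot wedge_gram mxE.
have AB : A *m A^t* + B *m B^t* = 1%:M.
  transitivity (psi *m (g^t* *m g + f^t* *m f) *m psi^t*).
    by rewrite mulmxDr mulmxDl !adjM !trmxCK !mulmxA.
  by rewrite orbitals_complete // mulmx1 (unitarymxP pp).
rewrite c2E; apply: le_trans (cofactor_block AB) _.
apply: ler_wpM2r; first by rewrite addr_ge0 // exprn_ge0.
pose E (i : 'I_p * 'I_n) := excitation g f i.1 i.2.
have -> : \tr (\adj A *m B *m (\adj A *m B)^t*) =
    \sum_i `|dot (E i) (wedge psi)| ^+ 2.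
  rewrite -(pair_bigA _ (fun a mu => `|dot (excitation g f a mu) _| ^+ 2)) /=.
  rewrite exchange_big /=; apply: eq_bigr => mu _; rewrite mxE.
  apply: eq_bigr => a _; rewrite /dot excitation_wedge // -/A -/B.
  by rewrite [X in `|X|]mxE eqxx mulr1n normCK; congr (_ * _); rewrite !mxE.
apply: bessel => [|i|[a mu] [b nu]].
- exact: excitation_proj_adj.
- exact: excitation_proj_id.
by rewrite /dot excitation_orthonormal // mxE eqxx mulr1n.
Qed.

End ExcitationProj.

(** * Passage between complex inner products and real norms *)

Section ComplexNorms.
Variables (R : realType) (m : nat).
Local Notation C := R[i].
Local Notation N := (fock_dim m).
Implicit Types (u v : 'cV[C]_N).
Import ComplexField.Normc.
Local Open Scope complex_scope.

Lemma normCE (z : C) : `|z| = (normc z)%:C.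
Proof. by rewrite normc_def; case: z. Qed.

Lemma normc_ge0 (z : C) : 0 <= normc z.
Proof. by case: z => a b; exact: sqrtr_ge0. Qed.

Lemma vnorm_ge0 u : 0 <= vnorm u.
Proof. exact: sqrtr_ge0. Qed.

Lemma dot_vnorm u : dot u u = (vnorm u ^+ 2)%:C.
Proof.
rewrite sqr_sqrtr ?sumr_ge0 // => [|i _]; last exact: sqr_ge0.
rewrite rmorph_sum /= /dot mxE; apply: eq_bigr => i _.
by rewrite rmorphXn /= -normCE normCK mulrC !mxE.
Qed.

Lemma normc_dot_le u v : normc (dot u v) <= vnorm u * vnorm v.
Proof.
rewrite -ler_sqr ?nnegrE ?normc_ge0 ?mulr_ge0 ?vnorm_ge0 //.
rewrite -lecR rmorphXn exprMn /= -normCE rmorphM /= -!dot_vnorm.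
exact: cauchy_schwarz.
Qed.

Lemma overlap_pythagoras u v : dot u u = 1 -> dot v v = 1 ->
  vnorm (v - dot u v *: u) ^+ 2 = 1 - overlap2 u v.
Proof.
move=> uu vv; apply: (@complexI R).
rewrite -dot_vnorm rmorphB rmorph1 /overlap2 -/(dot u v) rmorphXn /=.
rewrite -normCE normCK dotDl !dotDr !(dotNl, dotNr, dotZl, dotZr) uu vv.
by rewrite -[dot v u]dot_conj; ring.
Qed.

Lemma overlap2_eq1 u v : dot u u = 1 -> dot v v = 1 -> overlap2 u v = 1 ->
  exists2 z : C, `|z| = 1 & v = z *: u.
Proof.
move=> uu vv uv; exists (dot u v).
  have /eqP := uv; rewrite /overlap2 -/(dot u v) pexpr_eq1 ?normc_ge0 // => /eqP.
  by rewrite normCE => ->.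
apply/eqP; rewrite -subr_eq0 -dot_eq0 dot_vnorm.
by rewrite overlap_pythagoras // uv subrr.
Qed.

End ComplexNorms.

(** * The fidelity bound *)

Section SlaterBound.
Variables (R : realType) (m n p : nat) (npm : (n + p)%N = m).
Local Notation C := R[i].
Local Notation N := (fock_dim m).
Variables (rho : 'M[C]_N) (hrho : density n rho).
Variables (g : 'M[C]_(n, m)) (f : 'M[C]_(p, m)).
Hypotheses (gg : g \is unitarymx) (ff : f \is unitarymx) (fg : f *m g^t* = 0).
Import ComplexField.Normc.
Local Open Scope complex_scope.
Local Notation G := (wedge g).
Local Notation P := (excitation_proj g f).

Lemma density_adj : rho^t* = rho.
Proof.
by case: hrho => _ /is_hermitianmxP; rewrite expr0 scale1r => <-.
Qed.

Lemma density_ge0 u : 0 <= dot u (rho *m u).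
Proof. by case: hrho => _ _ rho0 _; rewrite /dot mulmxA. Qed.

Lemma fidelityE u : (fidelity rho u)%:C = dot u (rho *m u).
Proof.
rewrite /fidelity -mulmxA RRe_real //; exact: ger0_real (density_ge0 u).
Qed.

Lemma fidelity_expansion (u v w r : 'cV[C]_N) (al : R) :
    dot u u = 1 -> 0 < al -> al = fidelity rho u ->
    w = v - dot u v *: u -> r = rho *m u - al%:C *: u ->
  fidelity rho v <= overlap2 u v * al
    + 2 * (normc (dot u v) * normc (dot r w))
    + (normc (dot r w) ^+ 2 / al
        + vnorm w ^+ 2 * (1 - (al ^+ 2 + vnorm r ^+ 2) / al)).
Proof.
move=> uu al0 alE wE rE; rewrite -lecR fidelityE.
have tr1 : \tr rho = 1 by case: hrho.
have alC : al%:C = dot u (rho *m u) by rewrite alE fidelityE.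
have al0C : 0 < al%:C :> C by rewrite ltcR.
have := density_expansion density_adj density_ge0 tr1 uu al0C alC erefl wE rE.
rewrite !normCE (dot_vnorm w) (dot_vnorm r).
rewrite -[overlap2 _ _]/(normc (dot u v) ^+ 2).
by rewrite !(rmorphM, rmorphB, rmorphD, rmorph1, rmorphXn, rmorph_nat, fmorphV).
Qed.

(** Stated for any orthogonal projector that annihilates u; the structure of Slater determinants
    enters through the last hypothesis. *)
Lemma fidelity_le_overlap (P : 'M[C]_N) (u v : 'cV[C]_N) :
    P^t* = P -> P *m P = P -> P *m u = 0 ->
    dot u u = 1 -> dot v v = 1 -> 0 < fidelity rho u ->
    2 * (overlap2 u v * (1 - overlap2 u v))
      <= vnorm (P *m v) ^+ 2 * (1 + overlap2 u v) ->
  fidelity rho v <=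
    fidelity rho u - (3 * fidelity rho u / 2 - 1) * (1 - overlap2 u v)
    + 2 * vnorm (P *m rho *m u) * Num.sqrt (1 - overlap2 u v).
Proof.
move=> hP PP Pu uu vv al0 key; have w2 := overlap_pythagoras uu vv.
have := @fidelity_expansion u v _ _ _ uu al0 erefl erefl erefl.
(* Since P u = 0, subtracting multiples of u does not affect projections: P w = P v, and P r is the
   residual vector. *)
have : P *m (v - dot u v *: u) = P *m v.
  by rewrite mulmxBr -scalemxAr Pu scaler0 subr0.
have : P *m (rho *m u - (fidelity rho u)%:C *: u) = P *m rho *m u.
  by rewrite mulmxBr -scalemxAr Pu scaler0 subr0 mulmxA.
move: (v - _) w2 (rho *m u - _) => w w2 r Pr Pw /le_trans; apply.
have split x : vnorm x ^+ 2 = vnorm (P *m x) ^+ 2 + vnorm (x - P *m x) ^+ 2.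
  apply: (@complexI R); rewrite rmorphD /= -!dot_vnorm.
  exact: dot_proj_split.
rewrite -Pr (split r) (split w).
apply: slater_real_bound => //; try exact: vnorm_ge0; try exact: normc_ge0.
- by rewrite -split w2 addrC subrK.
- rewrite (dot_proj_split hP PP); apply: le_trans (le_normcD _ _) _.
  by apply: lerD; rewrite mulrC; exact: normc_dot_le.
by rewrite Pw.
Qed.

Lemma slater_fidelity_le (H : 'cV[C]_N) : slater n H -> 0 < fidelity rho G ->
  fidelity rho H <=
    fidelity rho G - (3 * fidelity rho G / 2 - 1) * (1 - overlap2 G H)
    + 2 * residual rho g f * Num.sqrt (1 - overlap2 G H).
Proof.
move=> [psi pp ->] al0; apply: fidelity_le_overlap => //.
- exact: excitation_proj_adj.
- exact: excitation_proj_idem.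
- exact: excitation_proj_ground gg fg.
- exact: wedge_norm.
- exact: wedge_norm.
have := excitation_weight gg ff fg npm pp.
rewrite normCE dot_vnorm -lecR /overlap2 -/(dot _ _).
by rewrite !(rmorphM, rmorphB, rmorphD, rmorph1, rmorphXn, rmorph_nat).
Qed.

End SlaterBound.

Theorem theorem7 (R : realType) (m n : nat) (hnm : (n <= m)%N)
    (rho : 'M[R[i]]_(fock_dim m)) (hrho : density n rho)
    (g : 'M[R[i]]_(n, m)) (hg : g \is unitarymx)
    (f : 'M[R[i]]_(m - n, m)) (hf : f \is unitarymx) (hfg : f *m g^t* = 0)
    (halpha : 2 / 3 <= fidelity rho (wedge g)) :
  let G := wedge g in
  let alpha := fidelity rho G in
  let RG := residual rho g f in
  [/\ forall H : 'cV[R[i]]_(fock_dim m), slater n H ->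
        fidelity rho H <=
          alpha - (3 * alpha / 2 - 1) * (1 - overlap2 G H)
          + 2 * RG * Num.sqrt (1 - overlap2 G H),
      2 / 3 < alpha -> RG = 0 ->
        (forall S : 'cV[R[i]]_(fock_dim m), slater n S ->
           fidelity rho S <= alpha)
        /\ (forall S : 'cV[R[i]]_(fock_dim m), slater n S ->
             fidelity rho S = alpha ->
             exists2 z : R[i], `|z| = 1 & S = z *: G)
    & forall Delta : R, 0 < Delta -> 2 / 3 + Delta <= alpha ->
        OPT n rho <= alpha + 2 / 3 * (RG ^+ 2 / Delta)].
Proof.
have npm : (n + (m - n))%N = m by rewrite subnKC.
move=> G alpha RG.
have al0 : 0 < alpha by lra.
have bound H : slater n H -> fidelity rho H <=
    alpha - (3 * alpha / 2 - 1) * (1 - overlap2 G H)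
      + 2 * RG * Num.sqrt (1 - overlap2 G H).
  by move=> sH; exact: slater_fidelity_le.
have nS (S : 'cV[R[i]]_(fock_dim m)) : slater n S -> dot S S = 1.
  by case=> psi pp ->; exact: wedge_norm.
have GG : dot G G = 1 by exact: wedge_norm.
have x0 S : slater n S -> 0 <= 1 - overlap2 G S.
  by move=> sS; rewrite -(overlap_pythagoras GG (nS S sS)) sqr_ge0.
split=> // [al23 R0|D D0 alD].
  have bound0 S : slater n S -> fidelity rho S <=
      alpha - (3 * alpha / 2 - 1) * (1 - overlap2 G S).
    by move=> sS; have := bound S sS; rewrite R0 mulr0 mul0r addr0.
  split=> S sS.
    have := bound0 S sS; have := x0 S sS.
    by move: (1 - _) => x x_ge0; nra.
  (* Equal fidelity leaves a positive multiple of 1 - |<G|S>|^2 that is at most 0, so the overlap is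
     1. *)
  move=> Sal; apply: overlap2_eq1 => //; first exact: nS.
  have := bound0 S sS; have := x0 S sS; rewrite Sal.
  by move: (overlap2 _ _) => c; nra.
apply: ge_sup; first by exists alpha; exists G => //; exists g.
move=> _ [S sS <-]; apply: le_trans (bound S sS) _.
have := x0 S sS; move: (1 - _ : R) => x x_ge0.
(* As alpha is at least 2/3 + D, the coefficient 3 alpha / 2 - 1 is at least 3 D / 2; the bound is
   then a concave quadratic in the square root of x. *)
have k0 : 0 < 3 * D / 2 by lra.
have := quadratic_opt RG (Num.sqrt x) k0; rewrite sqr_sqrtr //.
have -> : RG ^+ 2 / (3 * D / 2) = 2 / 3 * (RG ^+ 2 / D).
  by field; rewrite gt_eqF.
have : 3 * D / 2 * x <= (3 * alpha / 2 - 1) * x by apply: ler_wpM2r => //; lra.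
by move: (_ * (_ / D)) (2 * RG * _) => t1 t2 {hfg}; lra.
Qed.
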